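(* Let $A=\hat A=\{a_1,\dots,a_k\}\subset\mathbb{R}$ be finite, let $P$ be a probability mass function on $A$ with $P_i=P(a_i)>0$ for all $i$, and let $\rho:A\times A\to[0,\infty)$, $\rho_{ij}=\rho(a_i,a_j)$, be symmetric ($\rho_{ij}=\rho_{ji}$ for all $i,j$) with $\rho_{ij}=0$ if and only if $i=j$. Assume $D_{\max}=\min_j \sum_i P_i\rho_{ij}>0$. Let $X_1$ be a random variable with distribution $P$, and for each $D\in(0,D_{\max})$ let $f=f_D:A\to\mathbb{R}$ be the function defined in the context. Suppose that the rate-distortion function $R(D)$ is strictly convex over the range $D\in(0,D_{\max})$. If $f_D(X_1)=0$ with probability one for infinitely many $D\in(0,D_{\max})$, then $P$ is the uniform distribution on $A$ and $\rho$ is a permutation distortion measure, and therefore $f_D(X_1)=0$ with probability one for all $D\in(0,D_{\max})$.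
   Context: $\rho$ is called a permutation distortion measure if all rows of the matrix $(\rho_{ij})_{i,j=1,\dots,k}$ are permutations of one another (equivalently, by symmetry, all columns are). $\log$ is to base 2 and $\log_e$ is the natural logarithm. For a probability mass function $Q$ on $\hat A$ and $D\ge 0$ let $$R(P,Q,D)=\inf_{(X,Z)}\big[I(X;Z)+H(Q_Z\|Q)\big],$$ where the infimum is over jointly distributed $(X,Z)$ with values in $A\times\hat A$ such that $X$ has distribution $P$ and $E[\rho(X,Z)]\le D$; $Q_Z$ is the distribution of $Z$, $I$ is mutual information in bits, and $H(R\|Q)=\sum_{a}R(a)\log[R(a)/Q(a)]$ is relative entropy in bits. The rate-distortion function is $R(D)=\inf_{(X,Y)} I(X;Y)$, the infimum being over jointly distributed $(X,Y)$ in $A\times\hat A$ with $X\sim P$ and $E[\rho(X,Y)]\le D$; thus $R(D)=\inf_Q R(P,Q,D)$, the infimum being over all probability mass functions $Q$ on $\hat A$. For $\lambda\le 0$ let $\Lambda_{P,Q}(\lambda)=E_P\big[\log_e E_Q\big(e^{\lambda\rho(X,Y)}\big)\big]$, where $X\sim P$ and $Y\sim Q$ are independent and the inner expectation is over $Y$ only; let $\Lambda^*_{P,Q}(D)=\sup_{\lambda\le 0}[\lambda D-\Lambda_{P,Q}(\lambda)]$. Known facts used to define $f$: for every $D\in(0,D_{\max})$ there is a $Q^*$ with $R(P,Q^*,D)=R(D)$, and for such a $Q^*$ there is a unique $\lambda^*<0$ with $\Lambda'_{P,Q^*}(\lambda^* )=D$; it satisfies $\lambda^*D-\Lambda_{P,Q^*}(\lambda^*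 )=\Lambda^*_{P,Q^*}(D)=(\log_e 2)R(P,Q^*,D)=(\log_e 2)R(D)$. For each $D\in(0,D_{\max})$ choose such $Q^*$ and $\lambda^*$ (depending on $D$) and define, for $x\in A$, $$f(x)=f_D(x)=(\log e)\Big[\lambda^*D-\log_e E_{Q^*}\big(e^{\lambda^*\rho(x,Y)}\big)\Big]-R(D),\qquad Y\sim Q^*.$$ *)

(* Defs.v *)
From mathcomp Require Import all_boot all_order all_algebra finmap.
From mathcomp Require Import all_classical all_reals all_analysis.
Set Implicit Arguments.
Unset Strict Implicit.
Unset Printing Implicit Defensive.
Import Order.TTheory GRing.Theory Num.Theory.
Import numFieldNormedType.Exports.
Local Open Scope classical_set_scope.
Local Open Scope ring_scope.

Definition log2 {R : realType} (x : R) : R := ln x / ln 2.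

Definition is_pmf {R : realType} {A : finType} (P : A -> R) : Prop :=
  (forall a, 0 <= P a) /\ \sum_a P a = 1.

Definition uniform_pmf {R : realType} {A : finType} (P : A -> R) : Prop :=
  forall a, P a = #|A|%:R^-1.

(* Conventions: 0 log (0/q) = 0 (including q = 0), r log (r/0) = +oo if r > 0. *)
Definition rel_entropy {R : realType} {A : finType} (S Q : A -> R) : \bar R :=
  (\sum_a (if (S a == 0)%R then 0
           else if (Q a == 0)%R then +oo
           else (S a * log2 (S a / Q a))%:E))%E.

(* A jointly distributed pair (X, Z) with values in A * B enters only through
   its joint probability mass function W. *)
Definition marg1 {R : realType} {A B : finType} (W : A * B -> R) (a : A) : R :=
  \sum_b W (a, b).

Definition marg2 {R : realType} {A B : finType} (W : A * B -> R) (b : B) : R :=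
  \sum_a W (a, b).

Definition mutual_info {R : realType} {A B : finType} (W : A * B -> R)
    : \bar R :=
  rel_entropy W (fun ab => marg1 W ab.1 * marg2 W ab.2).

Definition mean_distortion {R : realType} {A B : finType}
    (rho : A -> B -> R) (W : A * B -> R) : R :=
  \sum_ab W ab * rho ab.1 ab.2.

Definition admissible {R : realType} {A B : finType}
    (P : A -> R) (rho : A -> B -> R) (D : R) (W : A * B -> R) : Prop :=
  [/\ is_pmf W, marg1 W =1 P & mean_distortion rho W <= D].

(* R(P,Q,D), possibly +oo *)
Definition rate_fun {R : realType} {A B : finType}
    (P : A -> R) (rho : A -> B -> R) (Q : B -> R) (D : R) : \bar R :=
  ereal_inf [set (mutual_info W + rel_entropy (marg2 W) Q)%E
            | W in admissible P rho D].

(* R(D) *)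
Definition rate_distortion {R : realType} {A B : finType}
    (P : A -> R) (rho : A -> B -> R) (D : R) : \bar R :=
  ereal_inf [set mutual_info W | W in admissible P rho D].

(* E_Q(e^{l rho(x,Y)}) *)
Definition exp_moment {R : realType} {A B : finType}
    (rho : A -> B -> R) (Q : B -> R) (l : R) (x : A) : R :=
  \sum_y Q y * expR (l * rho x y).

(* Lambda_{P,Q}(l), defined for every real l by the same formula; its derivative
   is only ever taken at points l < 0. *)
Definition Lambda {R : realType} {A B : finType}
    (P : A -> R) (rho : A -> B -> R) (Q : B -> R) (l : R) : R :=
  \sum_x P x * ln (exp_moment rho Q l x).

(* The least average distortion of a constant reproduction symbol; the infimum
   is a minimum, B being finite (and nonempty in every use). *)
Definition Dmax {R : realType} {A B : finType}
    (P : A -> R) (rho : A -> B -> R) : R :=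
  inf (range (fun j : B => \sum_i P i * rho i j)).

(* A legitimate pair: Q attains R(D) as inf_Q R(P,Q,D), and l is the matching
   tilting parameter. *)
Definition optimal_choice {R : realType} {A B : finType}
    (P : A -> R) (rho : A -> B -> R) (D : R) (Q : B -> R) (l : R) : Prop :=
  [/\ is_pmf Q,
      rate_fun P rho Q D = rate_distortion P rho D,
      l < 0
    & is_derive l 1 (Lambda P rho Q) D].

(* f_D, built from a choice (Q, l). Here [log2 (expR 1)] is the base-2 log of e,
   and R(D) is finite for 0 <= D as soon as every source symbol has a
   reproduction symbol at distortion 0. *)
Definition f_dist {R : realType} {A B : finType}
    (P : A -> R) (rho : A -> B -> R) (D : R) (Q : B -> R) (l : R) (x : A) : R :=
  log2 (expR 1) * (l * D - ln (exp_moment rho Q l x))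
  - fine (rate_distortion P rho D).

Definition permutation_distortion {R : realType} {A B : finType}
    (rho : A -> B -> R) : Prop :=
  forall i j : A, perm_eq (codom (rho i)) (codom (rho j)).

Definition strictly_convex_on {R : realType} (I : set R) (g : R -> R) : Prop :=
  forall x y t : R, I x -> I y -> x != y -> 0 < t < 1 ->
    g (t * x + (1 - t) * y) < t * g x + (1 - t) * g y.

(* Main.v *)
Require Import Defs.
From HB Require Import structures.
From mathcomp Require Import all_boot all_order all_algebra finmap.
From mathcomp Require Import all_classical all_reals all_analysis.
From mathcomp Require Import perm ring lra.
Set Implicit Arguments.
Unset Strict Implicit.
Unset Printing Implicit Defensive.
Import Order.TTheory GRing.Theory Num.Theory.
Import numFieldNormedType.Exports.
Local Open Scope classical_set_scope.
Local Open Scope ring_scope.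

(** Let W be the coupling proportional to P(x) Q(y) e^(l rho(x,y)) in y. If Q
    attains R(D), then W has output law Q, and f_D = 0 says that
    E_Q e^(l rho(x,Y)) is a constant K in x; hence sum_x P(x) e^(l rho(x,y)) = K
    for every y in the support of Q. Among infinitely many D, infinitely many
    share one support S; for a fixed l, R would be affine along them, so strict
    convexity gives infinitely many l. Exponential sums with infinitely many
    zeros have vanishing coefficients: if S were a proper subset, this would
    contradict a determinant with constant term 1, and for S = A it says that
    the P-mass of each sphere {x | rho x y = r} is independent of y. Radius 0
    gives uniformity, the other radii the permutation property.
    Conversely, for P uniform and rho a permutation measure, the tilting of the
    uniform law with mean distortion D, compared with (Q, l) by Gibbs'
    inequality, forces E_Q e^(l rho(x,Y)) to be constant in x. *)

(** * Exponential sums *)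

Lemma is_derive_bigsum (R : realType) (I : Type) (s : seq I)
    (f : I -> R -> R) (df : I -> R) (x : R) :
  (forall i, is_derive x 1 (f i) (df i)) ->
  is_derive x 1 (fun l => \sum_(i <- s) f i l) (\sum_(i <- s) df i).
Proof.
move=> fdf; elim: s => [|i s IHs].
  rewrite big_nil (_ : (fun _ => _) = cst 0); last first.
    by apply/funext => l; rewrite big_nil.
  exact: is_derive_cst.
rewrite big_cons (_ : (fun _ => _) = f i + (fun l => \sum_(j <- s) f j l)).
  exact: is_deriveD.
by apply/funext => l; rewrite big_cons.
Qed.

Lemma is_derive_expRM (R : realType) (a r x : R) :
  is_derive x 1 (fun l => a * expR (l * r)) (a * r * expR (x * r)).
Proof.
rewrite (_ : (fun _ => _) = a \*: (expR \o ( *%R^~ r))); last exact/funext.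
apply: is_derive_eq.
by rewrite /GRing.scale /=; ring.
Qed.

(** The first zero is kept apart from the list, so that the loss of exactly one zero reads as an
    equality of sizes. *)
Lemma rolle_path (R : realType) (f f' : R -> R) (z : R) (zs : seq R) :
  (forall x : R, is_derive x 1 f (f' x)) -> path <%R z zs ->
  {in z :: zs, forall y, f y = 0} ->
  exists ws,
    [/\ path <%R z ws, size ws = size zs & {in ws, forall w, f' w = 0}].
Proof.
move=> fdf; elim: zs z => [|z1 zs IHzs] z /=; first by exists [::].
case/andP=> zz1 z1zs f0.
have [|ws [z1ws szws ws0]] := IHzs z1 z1zs.
  by move=> y yzs; apply: f0; rewrite inE yzs orbT.
have [|||c] := @Rolle R f z z1 zz1.
- by move=> x _; apply: ex_derive.
- by apply: derivable_within_continuous => x _; apply: ex_derive.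
- by rewrite !f0 // !inE eqxx ?orbT.
rewrite in_itv /= => /andP[zc cz1] fc.
exists (c :: ws); split; rewrite /= ?szws ?zc //=.
  by apply: path_le z1ws => //; exact: lt_trans.
move=> w; rewrite inE => /orP[/eqP ->|/ws0 //].
by rewrite -(@derive_val _ _ _ _ _ _ _ (fdf c)) (@derive_val _ _ _ _ _ _ _ fc).
Qed.

(* Dividing by the first exponential turns it into a constant, which
   differentiation kills; Rolle loses only one zero. *)
Lemma expsum_zeros (R : realType) (s : seq (R * R)) (zs : seq R) :
  sorted <%R zs -> size zs = size s ->
  {in zs, forall z, \sum_(p <- s) p.1 * expR (z * p.2) = 0} ->
  forall z, \sum_(p <- s) p.1 * expR (z * p.2) = 0.
Proof.
have [n] := ubnP (size s); elim: n s zs => // n IHn [|[c r] s] [|z0 zs] //.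
  by move=> _ _ _ _ z; rewrite big_nil.
rewrite /= ltnS => sn z0zs [szs] s0.
pose g l := c * expR (l * 0) + \sum_(p <- s) p.1 * expR (l * (p.2 - r)).
have gE l : \sum_(p <- (c, r) :: s) p.1 * expR (l * p.2) = expR (l * r) * g l.
  rewrite big_cons /g mulrDr mulr0 expR0 mulr1 [c * _]mulrC mulr_sumr.
  congr (_ + _); apply: eq_bigr => p _.
  by rewrite mulrCA -expRD; congr (_ * expR _); ring.
(* The terms of the derivative of [g]; the constant is gone, so this list is one shorter than the
   original. *)
pose s' : seq (R * R) := [seq (p.1 * (p.2 - r), p.2 - r) | p <- s].
pose g' (l : R) := \sum_(p <- s') p.1 * expR (l * p.2).
have gg' (x : R) : is_derive x 1 g (g' x).
  rewrite /g' big_map /= -[\sum_(_ <- _) _]add0r.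
  rewrite (_ : g = (fun l => c * expR (l * 0)) +
    (fun l => \sum_(p <- s) p.1 * expR (l * (p.2 - r)))) //.
  apply: is_deriveD; first by apply: is_derive_eq (is_derive_expRM _ _ _) _; ring.
  by apply: is_derive_bigsum => p; apply: is_derive_expRM.
have g0 : {in z0 :: zs, forall y, g y = 0}.
  move=> y /s0; rewrite gE => /eqP; rewrite mulf_eq0 expR_eq0 /=.
  by move/eqP.
have [ws [z0ws szws ws0]] := rolle_path gg' z0zs g0.
have g'0 : forall z, g' z = 0.
  apply: (IHn s' ws) => //; first by rewrite size_map.
  - exact: path_sorted z0ws.
  - by rewrite szws szs size_map.
move=> z.
have -> : \sum_(p <- (c, r) :: s) p.1 * expR (z * p.2) = expR (z * r) * g z0.
  rewrite gE; congr (_ * _); apply: is_derive_0_is_cst => x.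
  by apply: is_derive_eq (g'0 x); exact: gg'.
by rewrite g0 ?inE ?eqxx // mulr0.
Qed.

(** By [expsum_zeros] the sum vanishes at every real, in particular at naturals [j], where it is the
    moment of order [j] at the nodes [expR (r i)]. A polynomial vanishing at all nodes except
    [expR x] then isolates the coefficient. *)
Lemma expsum_coef (R : realType) (I : finType) (c r : I -> R) (Z : set R) :
  infinite_set Z ->
  (forall l, Z l -> \sum_i c i * expR (l * r i) = 0) ->
  forall x, \sum_(i | r i == x) c i = 0.
Proof.
move=> Zinf Z0 x.
have c0 l : \sum_i c i * expR (l * r i) = 0.
  pose s := [seq (c i, r i) | i <- index_enum I].
  have sE l' : \sum_(p <- s) p.1 * expR (l' * p.2) = \sum_i c i * expR (l' * r i).
    by rewrite big_map.
  have [B BZ szB] := infinite_set_fset (size s) Zinf.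
  pose zs := take (size s) (sort <=%R B).
  rewrite -sE; apply: (@expsum_zeros R s zs) => [||z zzs].
  - apply: take_sorted.
    by rewrite sort_lt_sorted fset_uniq.
  - by rewrite size_takel // size_sort.
  - rewrite sE; apply/Z0/BZ => /=.
    by have := mem_take zzs; rewrite mem_sort.
have p0 (p : {poly R}) : \sum_i c i * p.[expR (r i)] = 0.
  under eq_bigr do rewrite horner_coef mulr_sumr.
  rewrite exchange_big big1 //= => j _.
  under eq_bigr do rewrite -expRM_natl mulrCA.
  by rewrite -mulr_sumr c0 mulr0.
pose p : {poly R} := \prod_(i | r i != x) ('X - (expR (r i))%:P).
have px : p.[expR x] != 0.
  rewrite horner_prod; apply/prodf_neq0 => i rix.
  by rewrite !hornerE subr_eq0 (inj_eq (@expR_inj R)) eq_sym.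
apply: (mulIf px); rewrite mul0r mulr_suml -[RHS](p0 p).
rewrite [RHS](bigID (fun i => r i == x)) /= [X in _ + X]big1 ?addr0.
  by apply: eq_bigr => i /eqP ->.
by move=> i rix; rewrite /p (bigD1 i) //= hornerM hornerXsubC subrr mul0r mulr0.
Qed.

(** * Relative entropy and tilted couplings *)

Definition dominated (R : realType) (A : finType) (S T : A -> R) :=
  forall a, T a = 0 -> S a = 0.

(* Relative entropy in nats; meaningful only when [dominated S T]. *)
Definition kl (R : realType) (A : finType) (S T : A -> R) : R :=
  \sum_a S a * ln (S a / T a).

Lemma rel_entropyE (R : realType) (A : finType) (S T : A -> R) :
  dominated S T -> rel_entropy S T = (kl S T / ln 2)%:E.
Proof.
move=> ST; rewrite /kl mulr_suml -sumEFin; apply: eq_bigr => a _.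
case: eqP => [->|Sa]; first by rewrite !mul0r.
by case: eqP => [/ST //|_]; rewrite /log2 mulrA.
Qed.

Lemma rel_entropy_pinfty (R : realType) (A : finType) (S T : A -> R) :
  ~ dominated S T -> rel_entropy S T = +oo%E.
Proof.
move=> /existsNP[a /not_implyP[Ta /eqP/negbTE Sa]].
apply/esum_eqyP => [b _|]; first by case: ifP => // _; case: ifP.
by exists a; split; rewrite ?mem_index_enum // Sa Ta eqxx.
Qed.

(** For positive [s] and [t] this is [1 + u < expR u] at a nonzero [u = ln (t / s)], multiplied by
    [s]. *)
Lemma mul_ln_div_ge (R : realType) (s t : R) :
  0 <= s -> 0 <= t -> (t = 0 -> s = 0) ->
  s - t <= s * ln (s / t) ?= iff (s == t).
Proof.
move=> s0 t0 ts; apply/leifP.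
have [st|st] := eqVneq s t.
  rewrite st; have [->|tn0] := eqVneq t 0; first by rewrite subrr mul0r.
  by rewrite divff // ln1 mulr0 subrr.
have [sE|sn0] := eqVneq s 0.
  by rewrite sE mul0r sub0r oppr_lt0 lt_neqAle t0 andbT -sE.
have {}s0 : 0 < s by rewrite lt_neqAle eq_sym sn0.
have {}t0 : 0 < t.
  by rewrite lt_neqAle t0 andbT; apply/eqP => /esym/ts/eqP; apply/negP.
have ts_gt0 : t / s \is Num.pos by rewrite posrE divr_gt0.
have /(@expR_gt1Dx R) : ln (t / s) != 0.
  rewrite ln_eq0 ?divr_gt0 //; apply: contra st => /eqP ts1.
  by rewrite -(divfK sn0 t) ts1 mul1r.
rewrite lnK //.
rewrite -(ltr_pM2l s0) mulrDr mulr1 mulrCA divff ?mulr1 // => lt_t.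
by rewrite -[s / t]invf_div lnV // mulrN; lra.
Qed.

(** Gibbs' inequality, summed termwise; the equality case later turns a vanishing divergence into an
    equality of laws. *)
Lemma kl_leif (R : realType) (A : finType) (S T : A -> R) :
  (forall a, 0 <= S a) -> (forall a, 0 <= T a) -> dominated S T ->
  \sum_a S a = \sum_a T a -> 0 <= kl S T ?= iff [forall a, S a == T a].
Proof.
move=> S0 T0 ST eST.
rewrite -(subrr (\sum_a T a)) -{1}eST -sumrB.
by apply: leif_sum => a _; apply: mul_ln_div_ge => // /ST.
Qed.

Lemma kl_ge0 (R : realType) (A : finType) (S T : A -> R) :
  is_pmf S -> is_pmf T -> dominated S T -> 0 <= kl S T.
Proof.
by move=> [S0 S1] [T0 T1] ST; rewrite (kl_leif S0 T0 ST) // S1 T1.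
Qed.

Lemma kl_le0_eq (R : realType) (A : finType) (S T : A -> R) :
  is_pmf S -> is_pmf T -> dominated S T -> kl S T <= 0 -> S =1 T.
Proof.
move=> [S0 S1] [T0 T1] ST; rewrite (ge_leif (kl_leif S0 T0 ST _)) ?S1 ?T1 //.
by move=> /forallP e a; apply/eqP.
Qed.

Lemma kl_self (R : realType) (A : finType) (S : A -> R) : kl S S = 0.
Proof.
apply: big1 => a _; have [->|Sa] := eqVneq (S a) 0; first by rewrite mul0r.
by rewrite divff // ln1 mulr0.
Qed.

(** * Joint laws and their marginals *)

Lemma sum_pair (R : realType) (A B : finType) (F : A * B -> R) :
  \sum_ab F ab = \sum_a \sum_b F (a, b).
Proof. by rewrite pair_bigA; apply: eq_bigr => -[]. Qed.

Lemma sum_marg1 (R : realType) (A B : finType) (W : A * B -> R) (g : A -> R) :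
  \sum_a marg1 W a * g a = \sum_ab W ab * g ab.1.
Proof.
rewrite sum_pair.
by apply: eq_bigr => a _; rewrite mulr_suml.
Qed.

Lemma sum_marg2 (R : realType) (A B : finType) (W : A * B -> R) (g : B -> R) :
  \sum_b marg2 W b * g b = \sum_ab W ab * g ab.2.
Proof.
rewrite sum_pair exchange_big /=.
by apply: eq_bigr => b _; rewrite mulr_suml.
Qed.

Lemma marg1_ge (R : realType) (A B : finType) (W : A * B -> R) :
  (forall ab, 0 <= W ab) -> forall ab, W ab <= marg1 W ab.1.
Proof.
by move=> W0 [a b]; rewrite /marg1 (bigD1 b) //= lerDl sumr_ge0.
Qed.

Lemma marg2_ge (R : realType) (A B : finType) (W : A * B -> R) :
  (forall ab, 0 <= W ab) -> forall ab, W ab <= marg2 W ab.2.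
Proof.
by move=> W0 [a b]; rewrite /marg2 (bigD1 a) //= lerDl sumr_ge0.
Qed.

Lemma marg2_pmf (R : realType) (A B : finType) (W : A * B -> R) :
  is_pmf W -> is_pmf (marg2 W).
Proof.
move=> [W0 W1]; split=> [b|]; first exact: sumr_ge0.
have := sum_marg2 W (fun=> 1); rewrite -[RHS]mulr_suml W1 mulr1 -mulr_suml.
by rewrite mulr1.
Qed.

Lemma dominated_marg (R : realType) (A B : finType) (W : A * B -> R) :
  (forall ab, 0 <= W ab) ->
  dominated W (fun ab => marg1 W ab.1 * marg2 W ab.2).
Proof.
move=> W0 ab /eqP; rewrite mulf_eq0 => /orP[] /eqP e.
- by apply/le_anti; rewrite W0 andbT -e marg1_ge.
- by apply/le_anti; rewrite W0 andbT -e marg2_ge.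
Qed.

(** * Exponential tilting *)

Lemma exp_moment_gt0 (R : realType) (A B : finType) (rho : A -> B -> R)
    (Q : B -> R) (l : R) (x : A) :
  is_pmf Q -> 0 < exp_moment rho Q l x.
Proof.
move=> [Q0 Q1].
have E0 y : 0 <= Q y * expR (l * rho x y) by rewrite mulr_ge0 ?expR_ge0.
rewrite lt_neqAle sumr_ge0 // andbT; apply/eqP => /esym/psumr_eq0P E.
have /eqP := Q1; rewrite big1 => [|y _]; first by rewrite eq_sym oner_eq0.
by apply/eqP; have /eqP := E (fun y _ => E0 y) y isT; rewrite mulf_eq0 expR_eq0 orbF.
Qed.

(** Given [x], the second coordinate follows the Gibbs reweighting of [Q] by [expR (l * rho x y)],
    with [exp_moment] as partition function. *)
Definition tilt (R : realType) (A B : finType) (P : A -> R)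
    (rho : A -> B -> R) (Q : B -> R) (l : R) (ab : A * B) : R :=
  P ab.1 * Q ab.2 * expR (l * rho ab.1 ab.2) / exp_moment rho Q l ab.1.

Lemma marg1_tilt (R : realType) (A B : finType) (P : A -> R)
    (rho : A -> B -> R) (Q : B -> R) (l : R) :
  is_pmf Q -> marg1 (tilt P rho Q l) =1 P.
Proof.
move=> Qpmf a; rewrite /marg1 /tilt /= -mulr_suml.
under eq_bigr do rewrite -mulrA.
by rewrite -mulr_sumr mulfK // gt_eqF // exp_moment_gt0.
Qed.

Lemma tilt_pmf (R : realType) (A B : finType) (P : A -> R)
    (rho : A -> B -> R) (Q : B -> R) (l : R) :
  is_pmf P -> is_pmf Q -> is_pmf (tilt P rho Q l).
Proof.
move=> [P0 P1] Qpmf; split=> [ab|].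
  have [Q0 _] := Qpmf.
  by rewrite divr_ge0 ?mulr_ge0 ?expR_ge0 // ltW // exp_moment_gt0.
have := sum_marg1 (tilt P rho Q l) (fun=> 1); rewrite -[RHS]mulr_suml mulr1 => <-.
by rewrite -mulr_suml mulr1 -P1; apply: eq_bigr => a _; rewrite marg1_tilt.
Qed.

Lemma dominated_tilt (R : realType) (A B : finType) (P : A -> R)
    (rho : A -> B -> R) (Q : B -> R) (l : R) (W : A * B -> R) :
  (forall ab, 0 <= W ab) -> is_pmf Q -> marg1 W =1 P ->
  dominated (marg2 W) Q -> dominated W (tilt P rho Q l).
Proof.
move=> W0 Qpmf WP WQ [a b] /eqP; rewrite /tilt /= !mulf_eq0 invr_eq0.
rewrite expR_eq0 (gt_eqF (exp_moment_gt0 _ _ _ Qpmf)) !orbF => /orP[]/eqP e.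
- by apply/le_anti; rewrite W0 andbT -e -WP (marg1_ge W0).
- by apply/le_anti; rewrite W0 andbT -(WQ b e) (marg2_ge W0 (a, b)).
Qed.

Lemma dominated_marg2_tilt (R : realType) (A B : finType) (P : A -> R)
    (rho : A -> B -> R) (Q : B -> R) (l : R) :
  dominated (marg2 (tilt P rho Q l)) Q.
Proof.
by move=> b Qb; apply: big1 => a _; rewrite /tilt /= Qb mulr0 !mul0r.
Qed.

(** The left side is the divergence of [W] from the product of [P] and [Q]. Taking the tilt as
    reference instead changes the log ratio by [l * rho] minus the log of the normalizer, which is
    then averaged under [W]. *)
Lemma informationE (R : realType) (A B : finType) (P : A -> R)
    (rho : A -> B -> R) (Q : B -> R) (l : R) (W : A * B -> R) :
  is_pmf W -> is_pmf Q -> marg1 W =1 P -> dominated (marg2 W) Q ->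
  (mutual_info W + rel_entropy (marg2 W) Q)%E =
  ((kl W (tilt P rho Q l) + l * mean_distortion rho W - Lambda P rho Q l)
     / ln 2)%:E.
Proof.
move=> [W0 W1] Qpmf WP WQ.
rewrite /mutual_info !rel_entropyE //; last exact: dominated_marg.
rewrite -EFinD -mulrDl; congr (_ / _)%:E.
rewrite {2}/kl sum_marg2 /Lambda.
under [\sum_x P x * _]eq_bigr do rewrite -WP.
rewrite sum_marg1 /mean_distortion mulr_sumr /kl -!big_split -sumrB /=.
apply: eq_bigr => -[a b] _ /=.
have [->|Wab] := eqVneq (W (a, b)) 0; first by rewrite !mul0r mulr0 addr0 subr0.
have {}Wab : 0 < W (a, b) by rewrite lt_neqAle eq_sym Wab W0.
have P0 : 0 < P a by rewrite -WP (lt_le_trans Wab) // (marg1_ge W0 (a, b)).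
have W20 : 0 < marg2 W b by rewrite (lt_le_trans Wab) // (marg2_ge W0 (a, b)).
have Q0 : 0 < Q b.
  rewrite lt_neqAle; case: (Qpmf) => -> _; rewrite andbT.
  by apply/eqP => /esym/WQ W2; rewrite W2 ltxx in W20.
have E0 := exp_moment_gt0 rho l a Qpmf.
have e0 := expR_gt0 (l * rho a b).
rewrite /tilt /= WP !(ln_div, lnM, expRK) ?posrE ?(mulr_gt0, divr_gt0, invr_gt0) //.
by ring.
Qed.

(** Weak duality: the divergence in [informationE] is nonnegative, and [l <= 0] turns the distortion
    constraint into a lower bound. *)
Lemma information_ge (R : realType) (A B : finType) (P : A -> R)
    (rho : A -> B -> R) (Q : B -> R) (D l : R) (W : A * B -> R) :
  is_pmf P -> is_pmf Q -> l <= 0 -> admissible P rho D W ->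
  (((l * D - Lambda P rho Q l) / ln 2)%:E <=
   mutual_info W + rel_entropy (marg2 W) Q)%E.
Proof.
move=> Ppmf Qpmf l0 [Wpmf WP WD].
have [WQ|WQ] := pselect (dominated (marg2 W) Q); last first.
  rewrite (rel_entropy_pinfty WQ) addey ?leey //.
  by rewrite /mutual_info rel_entropyE //; apply: dominated_marg; case: Wpmf.
rewrite (informationE rho l Wpmf Qpmf WP WQ) lee_fin.
apply: ler_wpM2r; first by rewrite invr_ge0 ln_ge0 // ler1n.
rewrite lerD2r -[leLHS]add0r lerD //; last exact: ler_wnM2l.
apply: kl_ge0 => //; first exact: tilt_pmf.
by apply: dominated_tilt => //; case: Wpmf.
Qed.

Lemma information_tilt (R : realType) (A B : finType) (P : A -> R)
    (rho : A -> B -> R) (Q : B -> R) (l : R) :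
  is_pmf P -> is_pmf Q ->
  (mutual_info (tilt P rho Q l) + rel_entropy (marg2 (tilt P rho Q l)) Q)%E =
  ((l * mean_distortion rho (tilt P rho Q l) - Lambda P rho Q l) / ln 2)%:E.
Proof.
move=> Ppmf Qpmf; rewrite (@informationE _ _ _ P rho _ l) ?kl_self ?add0r //.
- exact: tilt_pmf.
- exact: marg1_tilt.
- exact: dominated_marg2_tilt.
Qed.

(** [Lambda] averages log moment generating functions, so its derivative is the mean of [rho] under
    the tilt. *)
Lemma mean_distortion_tilt (R : realType) (A B : finType) (P : A -> R)
    (rho : A -> B -> R) (Q : B -> R) (D l : R) :
  is_pmf Q -> is_derive l 1 (Lambda P rho Q) D ->
  mean_distortion rho (tilt P rho Q l) = D.
Proof.
move=> Qpmf LD; rewrite -(@derive_val _ _ _ _ _ _ _ LD).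
pose dE x := \sum_y Q y * rho x y * expR (l * rho x y).
have dLambda : is_derive l 1 (Lambda P rho Q)
    (\sum_x P x * ((exp_moment rho Q l x)^-1 * dE x)).
  apply: is_derive_bigsum => x.
  have dEx : is_derive l 1 (fun m : R => exp_moment rho Q m x) (dE x).
    by apply: is_derive_bigsum => y; apply: is_derive_expRM.
  apply: (@is_deriveZ _ _ _ (fun m => ln (exp_moment rho Q m x)) (P x)).
  apply: (@is_derive1_comp _ (@ln R) (fun m : R => exp_moment rho Q m x)) => //.
  by apply: is_derive1_ln; rewrite exp_moment_gt0.
rewrite (@derive_val _ _ _ _ _ _ _ dLambda) /mean_distortion sum_pair.
apply: eq_bigr => x _; rewrite /dE !mulr_sumr; apply: eq_bigr => y _.
by rewrite /tilt /=; ring.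
Qed.

(** * Rates at an optimal choice *)

Lemma rate_funE (R : realType) (A B : finType) (P : A -> R)
    (rho : A -> B -> R) (Q : B -> R) (D l : R) :
  is_pmf P -> is_pmf Q -> l <= 0 -> is_derive l 1 (Lambda P rho Q) D ->
  rate_fun P rho Q D = ((l * D - Lambda P rho Q l) / ln 2)%:E.
Proof.
move=> Ppmf Qpmf l0 LD; have WD := mean_distortion_tilt Qpmf LD.
(* The tilt meets the constraint with equality and attains the bound of weak duality. *)
apply/le_anti/andP; split.
  apply: ereal_inf_lbound; exists (tilt P rho Q l).
    by split; [exact: tilt_pmf|exact: marg1_tilt|rewrite WD].
  by rewrite information_tilt // WD.
by apply: le_ereal_inf_tmp => _ [W adm <-]; exact: information_ge.
Qed.

Lemma optimal_rate_distortion (R : realType) (A B : finType) (P : A -> R)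
    (rho : A -> B -> R) (D : R) (Q : B -> R) (l : R) :
  is_pmf P -> optimal_choice P rho D Q l ->
  rate_distortion P rho D = ((l * D - Lambda P rho Q l) / ln 2)%:E.
Proof.
by move=> Ppmf [Qpmf <- l0 LD]; apply: rate_funE => //; exact: ltW.
Qed.

Lemma f_distE (R : realType) (A B : finType) (P : A -> R)
    (rho : A -> B -> R) (D : R) (Q : B -> R) (l : R) (x : A) :
  is_pmf P -> optimal_choice P rho D Q l ->
  f_dist P rho D Q l x = (Lambda P rho Q l - ln (exp_moment rho Q l x)) / ln 2.
Proof.
move=> Ppmf opt; rewrite /f_dist (optimal_rate_distortion Ppmf opt) /=.
by rewrite /log2 expRK; ring.
Qed.

(* The mutual information of the tilted coupling is at least R(D), which already
   equals that mutual information plus the divergence of its output from Q. *)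
Lemma optimal_marg2_tilt (R : realType) (A B : finType) (P : A -> R)
    (rho : A -> B -> R) (D : R) (Q : B -> R) (l : R) :
  is_pmf P -> optimal_choice P rho D Q l -> marg2 (tilt P rho Q l) =1 Q.
Proof.
move=> Ppmf opt; have RD := optimal_rate_distortion Ppmf opt.
case: opt => Qpmf _ l0 LD; have WD := mean_distortion_tilt Qpmf LD.
have Wpmf := tilt_pmf rho l Ppmf Qpmf.
have WQ : dominated (marg2 (tilt P rho Q l)) Q by exact: dominated_marg2_tilt.
apply: kl_le0_eq => //; first exact: marg2_pmf.
have : (rate_distortion P rho D <= mutual_info (tilt P rho Q l))%E.
  apply: ereal_inf_lbound; exists (tilt P rho Q l) => //.
  by split => //; [exact: marg1_tilt|rewrite WD].
rewrite RD -WD -information_tilt // /mutual_info !rel_entropyE //; last first.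
  by apply: dominated_marg; case: Wpmf.
by rewrite -EFinD lee_fin gerDl pmulr_lle0 // invr_gt0 ln_gt0 // ltr1n.
Qed.

Lemma f_dist0_exp_moment (R : realType) (A B : finType) (P : A -> R)
    (rho : A -> B -> R) (D : R) (Q : B -> R) (l : R) :
  is_pmf P -> optimal_choice P rho D Q l ->
  (forall x, f_dist P rho D Q l x = 0) ->
  forall x, exp_moment rho Q l x = expR (Lambda P rho Q l).
Proof.
move=> Ppmf opt f0 x; have /eqP := f0 x; rewrite (f_distE x Ppmf opt).
rewrite mulf_eq0 invr_eq0 (gt_eqF (ln_gt0 _)) ?ltr1n // orbF subr_eq0 => /eqP ->.
by rewrite lnK // posrE exp_moment_gt0 //; case: opt.
Qed.

(** With a constant normalizer [K], the output mass of the tilt at [y] is [Q y / K] times the sum;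
    by optimality it is also [Q y], which cancels. *)
Lemma f_dist0_support (R : realType) (A B : finType) (P : A -> R)
    (rho : A -> B -> R) (D : R) (Q : B -> R) (l : R) (y : B) :
  is_pmf P -> optimal_choice P rho D Q l ->
  (forall x, f_dist P rho D Q l x = 0) -> Q y != 0 ->
  \sum_x P x * expR (l * rho x y) = expR (Lambda P rho Q l).
Proof.
move=> Ppmf opt f0 Qy; have K0 := expR_gt0 (Lambda P rho Q l).
have QK : Q y / expR (Lambda P rho Q l) != 0.
  by rewrite mulf_neq0 // invr_eq0 gt_eqF.
apply: (mulfI QK); rewrite divfK ?(gt_eqF K0) //.
rewrite -[RHS](optimal_marg2_tilt Ppmf opt y).
rewrite /marg2 mulr_sumr; apply: eq_bigr => x _.
by rewrite /tilt /= (f_dist0_exp_moment Ppmf opt f0); ring.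
Qed.

(** * From a vanishing f_D to uniformity *)

(** The pigeonhole principle, applied below first to supports and then to tilting parameters. *)
Lemma finite_fibers (T U : Type) (f : T -> U) (Z : set T) :
  finite_set (f @` Z) ->
  (forall y, finite_set (Z `&` f @^-1` [set y])) -> finite_set Z.
Proof.
move=> fZ fib; rewrite (_ : Z = \bigcup_(y in f @` Z) (Z `&` f @^-1` [set y])).
  exact: bigcup_finite.
apply/seteqP; split=> [x Zx|x [y _ []//]].
by exists (f x) => //; exists x.
Qed.

(* The determinant below vanishes at every point of [Z], while as an exponential
   sum its constant coefficient is 1: only the identity permutation
   contributes to it. *)
Lemma constant_moment_support (R : realType) (A : finType)
    (rho : A -> A -> R) (S : {set A}) (Z : set R) :
  (forall i j, 0 <= rho i j) -> (forall i j, rho i j = 0 <-> i = j) ->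
  infinite_set Z ->
  (forall l, Z l -> exists (v : A -> R) (K : R), [/\ K != 0,
     forall y, y \notin S -> v y = 0 &
     forall x, \sum_y v y * expR (l * rho x y) = K]) ->
  S = [set: A]%SET.
Proof.
move=> rho_ge0 rho_eq0 Zinf Zv; apply/setP => j0; rewrite inE.
apply: contrapT => /negP j0S.
pose ev (i : 'I_#|A|) : A := enum_val i.
have ev_inj : injective ev by exact: enum_val_inj.
pose i0 : 'I_#|A| := enum_rank j0.
have evi0 : ev i0 = j0 by exact: enum_rankK.
(* Rows in [S] carry the exponentials, row [i0] is all ones, and the other rows are those of the
   identity matrix. *)
pose c i j : R := if (ev i \in S) || (i == i0) then 1 else (i == j)%:R.
pose r i j : R := if ev i \in S then rho (ev j) (ev i) else 0.
have r_ge0 i j : 0 <= r i j by rewrite /r; case: ifP.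
have r_id i : r i i = 0.
  by rewrite /r; case: ifP => // _; apply/rho_eq0.
pose C (s : {perm 'I_#|A|}) : R := (-1) ^+ s * \prod_i c i (s i).
pose E (s : {perm 'I_#|A|}) : R := \sum_i r i (s i).
have det0 l : Z l -> \sum_s C s * expR (l * E s) = 0.
  move=> /Zv[v [K [K0 vS vK]]].
  pose N : 'M[R]_#|A| := \matrix_(i, j) (c i j * expR (l * r i j)).
  have <- : \det N = \sum_s C s * expR (l * E s).
    apply: eq_bigr => s _; rewrite /C /E -mulrA; congr (_ * _).
    rewrite mulr_sumr expR_sum -big_split /=.
    by apply: eq_bigr => i _; rewrite mxE.
  (* In each column the ones of row [i0], weighted by [- K], cancel the constant moment [K]. *)
  apply/eqP/det0P; exists (\row_i (if i == i0 then - K else v (ev i))).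
    apply/eqP => /rowP/(_ i0); rewrite !mxE eqxx => /eqP.
    by rewrite oppr_eq0; apply/negP.
  apply/rowP => j; rewrite !mxE (bigD1 i0) //= !mxE eqxx.
  rewrite /c /r evi0 (negbTE j0S) eqxx /= mulr0 expR0 !mulr1.
  apply/eqP; rewrite addrC subr_eq0 -(vK (ev j)).
  rewrite [eqbRHS](reindex ev) /=; last exact/onW_bij/enum_val_bij.
  rewrite [eqbRHS](bigD1 i0) //= evi0 vS // mul0r add0r.
  apply/eqP/eq_bigr => i /negbTE ii0; rewrite !mxE ii0 /c /r ii0 orbF.
  by case: ifPn => [_|/vS ->]; rewrite ?mul1r // !mul0r.
have := expsum_coef Zinf det0 0.
rewrite (bigD1 (1%g : {perm 'I_#|A|})) /=; last first.
  by apply/eqP/big1 => i _; rewrite perm1.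
rewrite big1 => [|s /andP[/eqP Es s1]].
  apply/eqP; rewrite addr0 /C odd_perm1 expr0 mul1r big1 ?oner_eq0 // => i _.
  by rewrite perm1 /c eqxx; case: ifP.
apply: contraNeq s1 => Cs; apply/eqP/permP => i; rewrite perm1.
(* On rows in [S] a zero exponent forces a zero of [rho]; on the identity rows a nonzero coefficient
   forces the diagonal. Injectivity then fixes [i0]. *)
have fixed k : k != i0 -> s k = k.
  move=> ki0; have [kS|kS] := boolP (ev k \in S).
    have : r k (s k) = 0 by apply: (psumr_eq0P _ Es) => // j _; exact: r_ge0.
    by rewrite /r kS => /rho_eq0/ev_inj.
  move: Cs; rewrite /C mulf_eq0 signr_eq0 /= => /prodf_neq0/(_ k isT).
  by rewrite /c (negbTE kS) (negbTE ki0) /= pnatr_eq0 eqb0 negbK => /eqP.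
have [->|/fixed //] := eqVneq i i0.
by have [//|/fixed/perm_inj] := eqVneq (s i0) i0.
Qed.

Lemma pmf_support (R : realType) (A : finType) (Q : A -> R) :
  is_pmf Q -> exists y, Q y != 0.
Proof.
move=> [_ Q1]; apply: contrapT => /forallNP Q0.
have /eqP := Q1; rewrite big1 => [|y _]; first by rewrite eq_sym oner_eq0.
by have /negP := Q0 y; rewrite negbK => /eqP.
Qed.

Lemma infinite_set_three (R : realType) (Z : set R) :
  infinite_set Z -> exists a b c, [/\ Z a, Z b, Z c & a < b < c].
Proof.
move=> /(infinite_set_fset 3)[B BZ szB].
have sB : sorted <%R (sort <=%R B) by rewrite sort_lt_sorted fset_uniq.
have BE x : x \in sort <=%R B -> Z x by rewrite mem_sort => /BZ.
move: szB sB BE; rewrite -(size_sort <=%R); case: sort => [|a [|b [|c s]]] //= _.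
move=> /and3P[ab bc _] BE; exists a, b, c.
by split; rewrite ?ab //; apply: BE; rewrite !inE eqxx ?orbT.
Qed.

(** Three points suffice: the middle one is a convex combination of the outer two, where an affine
    function gives equality. *)
Lemma strictly_convex_not_affine (R : realType) (I : set R) (g : R -> R)
    (l k : R) (Z : set R) :
  strictly_convex_on I g -> Z `<=` I -> (forall x, Z x -> g x = l * x + k) ->
  finite_set Z.
Proof.
move=> gI ZI gZ; apply: contrapT => /infinite_set_three[a [b [c [Za Zb Zc]]]].
move=> /andP[ab bc]; have ac : 0 < c - a by lra.
have acN0 : c - a != 0 by rewrite gt_eqF.
have t01 : 0 < (c - b) / (c - a) < 1.
  by rewrite divr_gt0 ?[0 < c - b]subr_gt0 //= ltr_pdivrMr //; lra.
have /gI/(_ _ _ t01) : I a by exact: ZI.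
move=> /(_ c (ZI _ Zc)); rewrite lt_eqF ?(lt_trans ab) // => /(_ isT).
set t := _ / _; have -> : t * a + (1 - t) * c = b by rewrite /t; field.
rewrite !gZ // (_ : t * _ + _ = l * b + k) ?ltxx //.
by rewrite /t; field.
Qed.

Lemma uniform_permutation (R : realType) (A : finType) (P : A -> R)
    (rho : A -> A -> R) (Z : set R) :
  is_pmf P -> (forall i j, rho i j = rho j i) ->
  (forall i j, rho i j = 0 <-> i = j) -> infinite_set Z ->
  (forall l, Z l -> forall y y',
     \sum_x P x * expR (l * rho x y) = \sum_x P x * expR (l * rho x y')) ->
  uniform_pmf P /\ permutation_distortion rho.
Proof.
move=> [P0 P1] rho_sym rho_eq0 Zinf eZ.
have weight y y' r :
    \sum_(x | rho x y == r) P x = \sum_(x | rho x y' == r) P x.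
  (* Over two copies of [A], with a sign on the second, the difference of the two sums is a single
     exponential sum. *)
  pose c (s : A + A) := match s with inl x => P x | inr x => - P x end.
  pose e (s : A + A) := match s with inl x => rho x y | inr x => rho x y' end.
  have ce0 l : Z l -> \sum_s c s * expR (l * e s) = 0.
    move=> /eZ/(_ y y') E; rewrite big_sumType /= E -big_split big1 //= => x _.
    by rewrite mulNr subrr.
  have := expsum_coef Zinf ce0 r; rewrite big_sumType /= sumrN => /eqP.
  by rewrite subr_eq0 => /eqP.
have rho0 x y : (rho x y == 0) = (x == y).
  by apply/eqP/eqP => /rho_eq0.
(* The sphere of radius zero about [y] is [y] alone. *)
have Pc y y' : P y = P y'.
  by have := weight y y' 0; rewrite !(eq_bigl _ _ (fun x => rho0 x _)) !big_pred1_eq.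
have A0 : #|A|%:R != 0 :> R.
  rewrite pnatr_eq0 -lt0n; apply/card_gt0P.
  by have [y _] := pmf_support (conj P0 P1); exists y.
have Pu y : P y = #|A|%:R^-1.
  have Py : P y * #|A|%:R = 1.
    by rewrite mulr_natr -sumr_const -P1; apply: eq_bigr => x _; exact: Pc.
  by apply: (mulIf A0); rewrite Py mulVf.
split=> // i j; apply/allP => r _ /=.
(* Under the uniform law, sphere masses are multiplicities in a row up to the factor [#|A|];
   symmetry exchanges rows and columns. *)
have count_rho k :
    (count_mem r (codom (rho k)))%:R = #|A|%:R * \sum_(x | rho x k == r) P x.
  rewrite count_map -sum1_count natr_sum big_enum_cond /= mulr_sumr.
  by apply: eq_big => x; [rewrite rho_sym|rewrite Pu divff].
by rewrite -(eqr_nat R) !count_rho (weight i j).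
Qed.

Lemma f_dist0_uniform (R : realType) (A : finType) (P : A -> R)
    (rho : A -> A -> R) (Qs : R -> A -> R) (ls : R -> R) (I Z : set R) :
  is_pmf P -> (forall i j, 0 <= rho i j) -> (forall i j, rho i j = rho j i) ->
  (forall i j, rho i j = 0 <-> i = j) ->
  strictly_convex_on I (fun D => fine (rate_distortion P rho D)) ->
  Z `<=` I -> infinite_set Z ->
  (forall D, Z D -> optimal_choice P rho D (Qs D) (ls D)) ->
  (forall D, Z D -> forall x, f_dist P rho D (Qs D) (ls D) x = 0) ->
  uniform_pmf P /\ permutation_distortion rho.
Proof.
move=> Ppmf rho_ge0 rho_sym rho_eq0 Rconv ZI Zinf opt f0.
pose supp D : {set A} := [set y | Qs D y != 0]%SET.
(* [A] has finitely many subsets, so one support occurs infinitely often. *)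
have [S ZSinf] : exists S, infinite_set (Z `&` supp @^-1` [set S]).
  apply: contrapT => /forallNP fin; apply: Zinf.
  by apply: (finite_fibers (f := supp)) => [|S]; [exact: finite_finset|exact: contrapT].
set ZS := Z `&` _ in ZSinf.
have KE D y : ZS D -> y \in S ->
    \sum_x P x * expR (ls D * rho x y) = expR (Lambda P rho (Qs D) (ls D)).
  move=> [ZD /= SD]; rewrite -SD inE => Qy.
  by rewrite (f_dist0_support Ppmf (opt D ZD) (f0 D ZD) Qy).
have [y0 y0S] : exists y0, y0 \in S.
  have [D [ZD /= SD]] := infinite_setN0 ZSinf.
  have [Qpmf _ _ _] := opt D ZD; have [y Qy] := pmf_support Qpmf.
  by exists y; rewrite -SD inE.
(* On a fiber of [ls], the value of [Lambda] is read off at [y0] and depends on [l] alone, so the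
   rate is affine in [D] and strict convexity makes the fiber finite. *)
have Linf : infinite_set (ls @` ZS).
  move=> Lfin; apply: ZSinf; apply: finite_fibers Lfin _ => l.
  apply: (strictly_convex_not_affine (l := l / ln 2)
    (k := - ln (\sum_x P x * expR (l * rho x y0)) / ln 2) Rconv).
    by move=> D [[/ZI]].
  move=> D [ZSD /= <-]; rewrite (KE D y0 ZSD y0S) expRK.
  have [ZD _] := ZSD; rewrite (optimal_rate_distortion Ppmf (opt D ZD)) /=.
  by rewrite mulrBl mulNr mulrAC.
have ST : S = [set: A]%SET.
  apply: (constant_moment_support rho_ge0 rho_eq0 Linf) => _ [D [ZD /= SD] <-].
  exists (Qs D), (expR (Lambda P rho (Qs D) (ls D))); split.
  - by rewrite gt_eqF // expR_gt0.
  - by move=> y; rewrite -SD inE negbK => /eqP.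
  - by move=> x; apply: (f_dist0_exp_moment Ppmf (opt D ZD) (f0 D ZD)).
apply: (uniform_permutation Ppmf rho_sym rho_eq0 Linf) => _ [D ZSD <-] y y'.
by rewrite !KE // ST inE.
Qed.

(** * The uniform source *)

Lemma permutation_sum (R : realType) (A B : finType) (rho : A -> B -> R)
    (g : R -> R) (x x' : A) :
  permutation_distortion rho -> \sum_z g (rho x z) = \sum_z g (rho x' z).
Proof.
move=> rho_perm.
have codomE y : \sum_z g (rho y z) = \sum_(r <- codom (rho y)) g r.
  by rewrite big_map big_enum.
by rewrite !codomE; apply: perm_big.
Qed.

Lemma Dmax_le (R : realType) (A B : finType) (P : A -> R)
    (rho : A -> B -> R) (j : B) :
  is_pmf P -> (forall i j, 0 <= rho i j) -> Dmax P rho <= \sum_i P i * rho i j.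
Proof.
move=> [P0 _] rho_ge0; apply: ge_inf; last by exists j.
by exists 0 => _ [k _ <-]; apply: sumr_ge0 => i _; apply: mulr_ge0.
Qed.

(* [x expR (- c x) <= 1 / c] makes the sum nonpositive at [- n / D]. *)
Lemma tilted_mean_root (R : realType) (A : finType) (r : A -> R) (z0 : A)
    (D : R) :
  (forall z, 0 <= r z) -> r z0 = 0 -> 0 < D -> #|A|%:R * D <= \sum_z r z ->
  exists2 m, m <= 0 & \sum_z (r z - D) * expR (m * r z) = 0.
Proof.
move=> r0 rz0 D0 Dr; pose h m := \sum_z (r z - D) * expR (m * r z).
have n0 : 0 < #|A|%:R :> R by rewrite ltr0n; apply/card_gt0P; exists z0.
pose c := #|A|%:R / D; have c0 : 0 < c by rewrite divr_gt0.
have hc : h (- c) <= 0.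
  rewrite /h; under eq_bigr do rewrite mulrBl.
  rewrite sumrB -mulr_sumr subr_le0.
  apply: (@le_trans _ _ (\sum_(z : A) c^-1)).
    apply: ler_sum => z _; rewrite mulNr expRN ler_pdivrMr ?expR_gt0 //.
    rewrite -(ler_pM2l c0) mulrA divff ?gt_eqF // mul1r.
    by apply: le_trans (expR_ge1Dx _); rewrite lerDr.
  rewrite sumr_const -mulr_natr invf_div divfK ?gt_eqF //.
  (* The first sum is now bounded by [D], and the term [z0] of the remaining sum is already one. *)
  rewrite -[leLHS]mulr1 ler_pM2l // (bigD1 z0) //= rz0 mulr0 expR0 lerDl.
  by apply: sumr_ge0 => z _; apply: expR_ge0.
have h0 : 0 <= h 0.
  rewrite /h; under eq_bigr do rewrite mul0r expR0 mulr1.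
  by rewrite sumrB sumr_const -[D *+ _]mulr_natl subr_ge0.
have [|||m] := @IVT R h (- c) 0 0.
- by rewrite oppr_le0 ltW.
- apply: derivable_within_continuous => x _; apply: ex_derive.
  by apply: is_derive_bigsum => z; apply: is_derive_expRM.
- by rewrite ge_min hc le_max h0 orbT.
- by rewrite in_itv /= => /andP[_ m0] hm; exists m.
Qed.

(** The divergences [kl W (tilt P rho Q m)] and [kl P T] add up to the dual value at [(Q, l)] minus
    that at [(P, m)], which optimality makes nonpositive; hence both vanish. *)
Lemma uniform_f_dist0 (R : realType) (A : finType) (P : A -> R)
    (rho : A -> A -> R) (D : R) (Q : A -> R) (l : R) :
  is_pmf P -> uniform_pmf P -> (forall i j, 0 <= rho i j) ->
  (forall i j, rho i j = rho j i) -> (forall i j, rho i j = 0 <-> i = j) ->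
  permutation_distortion rho -> 0 < D < Dmax P rho ->
  optimal_choice P rho D Q l -> forall x, f_dist P rho D Q l x = 0.
Proof.
move=> Ppmf Pu rho_ge0 rho_sym rho_eq0 rho_perm /andP[D0 DDmax] opt x0.
have P_gt0 x : 0 < P x by rewrite Pu invr_gt0 ltr0n; apply/card_gt0P; exists x0.
have Dlt z : D < \sum_x P x * rho x z by apply: lt_le_trans (Dmax_le z Ppmf rho_ge0).
(* The equation says that row [x0] of the tilted uniform law has mean distortion [D]; the
   permutation property carries it to all rows. *)
have [m m0 root_x0] : exists2 m, m <= 0 &
    \sum_z (rho x0 z - D) * expR (m * rho x0 z) = 0.
  apply: (tilted_mean_root (z0 := x0)) => //; first exact/rho_eq0.
  have := ltW (Dlt x0); under eq_bigr do rewrite rho_sym Pu.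
  rewrite -mulr_sumr mulrC ler_pdivlMr 1?mulrC //.
  by rewrite -invr_gt0 -(Pu x0).
have root x : \sum_z (rho x z - D) * expR (m * rho x z) = 0.
  by rewrite (permutation_sum (fun r => (r - D) * expR (m * r)) x x0).
pose K := exp_moment rho P m x0.
have K0 : 0 < K by exact: exp_moment_gt0.
have EK x : exp_moment rho P m x = K.
  rewrite /K /exp_moment; under eq_bigr do rewrite Pu.
  under [RHS]eq_bigr do rewrite Pu.
  by rewrite -!mulr_sumr (permutation_sum (fun r => expR (m * r)) x x0).
have LP : Lambda P rho P m = ln K.
  rewrite /Lambda; under eq_bigr do rewrite EK.
  by rewrite -mulr_suml; case: Ppmf => _ ->; rewrite mul1r.
have meanP : mean_distortion rho (tilt P rho P m) = D.
  have <- : \sum_ab tilt P rho P m ab * D = D.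
    by rewrite -mulr_suml; case: (tilt_pmf rho m Ppmf Ppmf) => _ ->; rewrite mul1r.
  apply/eqP; rewrite -subr_eq0 -sumrB sum_pair big1 // => x _.
  transitivity (P x / #|A|%:R / K * \sum_z (rho x z - D) * expR (m * rho x z)).
    rewrite mulr_sumr; apply: eq_bigr => z _.
    by rewrite /tilt /= EK (Pu z); ring.
  by rewrite root mulr0.
(* The tilt of [P] is admissible, and adding its nonnegative output divergence only increases the
   bound. *)
have RP : (rate_distortion P rho D <= ((m * D - ln K) / ln 2)%:E)%E.
  have adm : admissible P rho D (tilt P rho P m).
    by split; [exact: tilt_pmf|exact: marg1_tilt|rewrite meanP].
  apply: (@le_trans _ _ (mutual_info (tilt P rho P m))).
    by apply: ereal_inf_lbound; exists (tilt P rho P m).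
  rewrite -LP -[in leRHS]meanP -information_tilt // leeDl //.
  have dom : dominated (marg2 (tilt P rho P m)) P by exact: dominated_marg2_tilt.
  rewrite rel_entropyE // lee_fin divr_ge0 ?ln_ge0 ?ler1n //.
  by apply: kl_ge0 => //; apply: marg2_pmf; exact: tilt_pmf.
have RQ := optimal_rate_distortion Ppmf opt.
have [Qpmf _ l0 LD] := opt; have WD := mean_distortion_tilt Qpmf LD.
have ln2 : 0 < (ln 2)^-1 :> R by rewrite invr_gt0 ln_gt0 // ltr1n.
have le_lm : l * D - Lambda P rho Q l <= m * D - ln K.
  by move: RP; rewrite RQ lee_fin ler_pM2r.
set W := tilt P rho Q l in WD.
have Wpmf : is_pmf W by exact: tilt_pmf.
have WP : marg1 W =1 P by exact: marg1_tilt.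
have WQ : dominated (marg2 W) Q by exact: dominated_marg2_tilt.
have klW : kl W (tilt P rho Q m) =
    l * D - Lambda P rho Q l - (m * D - Lambda P rho Q m).
  have := information_tilt rho l Ppmf Qpmf.
  rewrite -/W (informationE rho m Wpmf Qpmf WP WQ) WD => -[].
  by move=> /(mulIf (lt0r_neq0 ln2)); lra.
have domW : dominated W (tilt P rho Q m) by apply: dominated_tilt => //; case: Wpmf.
have tilt_pmf_m := tilt_pmf rho m Ppmf Qpmf.
have klW0 := kl_ge0 Wpmf tilt_pmf_m domW.
(* [P] reweighted by the normalizers of [Q]; its mass is one because, by symmetry, the column sums
   of [P x * expR (m * rho x y)] all equal [K]. *)
pose T x := P x * (exp_moment rho Q m x / K).
have T_gt0 x : 0 < T x by rewrite mulr_gt0 ?divr_gt0 // exp_moment_gt0.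
have Tpmf : is_pmf T.
  split=> [x|]; first exact: ltW.
  transitivity (\sum_x \sum_y Q y * (P x * expR (m * rho x y) / K)).
    apply: eq_bigr => x _; rewrite /T /exp_moment mulr_suml mulr_sumr.
    by apply: eq_bigr => y _; ring.
  rewrite exchange_big /=; case: Qpmf => _ <-; apply: eq_bigr => y _.
  rewrite -mulr_sumr -mulr_suml -[RHS]mulr1; congr (_ * _).
  have -> : \sum_x P x * expR (m * rho x y) = K.
    by rewrite -(EK y); apply: eq_bigr => x _; rewrite rho_sym !Pu.
  exact/divff/lt0r_neq0.
have klT : kl P T = ln K - Lambda P rho Q m.
  have -> : ln K = \sum_x P x * ln K.
    by rewrite -mulr_suml; case: Ppmf => _ ->; rewrite mul1r.
  rewrite -sumrB; apply: eq_bigr => x _; rewrite -mulrBr; congr (_ * _).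
  have E0 := exp_moment_gt0 rho m x Qpmf.
  rewrite /T invfM invf_div mulrA divff ?gt_eqF // mul1r.
  by rewrite ln_div ?posrE.
have domT : dominated P T by move=> x Tx; have := T_gt0 x; rewrite Tx ltxx.
have klT0 := kl_ge0 Ppmf Tpmf domT.
have PT : P =1 T by apply: kl_le0_eq => //; rewrite klT; lra.
have WT : W =1 tilt P rho Q m by apply: kl_le0_eq => //; rewrite klW; lra.
have EQK x : exp_moment rho Q m x = K.
  have := PT x; rewrite /T -[LHS]mulr1 => /(mulfI (lt0r_neq0 (P_gt0 x))) /esym.
  exact: divr1_eq.
(* Otherwise equality of the two tilts makes [rho x z] independent of [z] on the support of [Q], and
   the mean distortion [D] is that of the constant symbol [z0], which exceeds [D]. *)
have lm : l = m.
  apply: contrapT => /eqP lm; have [z0 Qz0] := pmf_support Qpmf.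
  have ratio x z : Q z != 0 ->
      (l - m) * rho x z = ln (exp_moment rho Q l x) - ln (exp_moment rho Q m x).
    move=> Qz; have := WT (x, z); rewrite /W /tilt /= -2![_ * expR _ / _]mulrA.
    have PQ : P x * Q z != 0 by rewrite mulf_neq0 // gt_eqF.
    move=> /(mulfI PQ) /(congr1 (@ln R)).
    rewrite !ln_div ?posrE ?expR_gt0 ?exp_moment_gt0 // !expRK; lra.
  have := Dlt z0; rewrite -WD /mean_distortion ltNge => /negP; apply.
  under [leLHS]eq_bigr do rewrite -WP.
  rewrite sum_marg1 le_eqVlt; apply/orP; left; apply/eqP/eq_bigr => -[x z] _ /=.
  have [Qz|Qz] := eqVneq (Q z) 0; first by rewrite /W /tilt /= Qz mulr0 !mul0r.
  congr (_ * _); have lm0 : l - m != 0 by rewrite subr_eq0.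
  by apply: (mulfI lm0); rewrite !ratio.
rewrite (f_distE _ Ppmf opt) lm EQK /Lambda.
under eq_bigr do rewrite EQK.
by rewrite -mulr_suml; case: Ppmf => _ ->; rewrite mul1r subrr mul0r.
Qed.

(** * Almost sure statements on a finite alphabet *)

Lemma probability1_all (R : realType) (A : {fset R}) (P : A -> R)
    (d : measure_display) (Omega : measurableType d) (Pr : probability Omega R)
    (X : Omega -> A) (F : set A) :
  measurable_fun [set: Omega] (fun w => val (X w) : R) ->
  (forall i, Pr [set w | X w = i] = (P i)%:E) -> (forall i, 0 < P i) ->
  Pr [set w | F (X w)] = 1%E <-> forall i, F i.
Proof.
move=> Xmeas Xlaw P0; split=> [F1 i|FT]; last first.
  rewrite (_ : [set _ | _] = setT) ?probability_setT //.
  by apply/seteqP; split=> // w _; exact: FT.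
have meas1 j : measurable [set w | X w = j].
  have -> : [set w | X w = j] =
      [set: Omega] `&` (fun w => val (X w) : R) @^-1` [set val j].
    by apply/seteqP; split=> [w /= ->|w [_ /= /val_inj]].
  by apply: Xmeas => //; exact: measurable_set1.
have measF : measurable [set w | F (X w)].
  have -> : [set w | F (X w)] = \bigcup_(j in F) [set w | X w = j].
    by apply/seteqP; split=> [w Fw|w [j Fj /= ->] //]; exists (X w).
  by apply: fin_bigcup_measurable => //; exact: finite_finset.
(* If [F] fails at [i], the event misses a set of positive mass [P i]. *)
apply: contrapT => Fi.
have : (Pr [set w | F (X w)] <= Pr (~` [set w | X w = i]))%E.
  apply: le_measure; rewrite ?inE; [exact: measF| |].
  - exact: measurableC.
  - by move=> w /= Fw Xw; apply: Fi; rewrite -Xw.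
by rewrite probability_setC // F1 Xlaw -EFinB lee_fin lerBrDr gerDl leNgt P0.
Qed.

Theorem corollary1 (R : realType) (A : {fset R})
  (P : A -> R) (rho : A -> A -> R)
  (d : measure_display) (Omega : measurableType d) (Pr : probability Omega R)
  (X1 : Omega -> A) (Qstar : R -> A -> R) (lstar : R -> R)
  (P_pmf : is_pmf P) (P_gt0 : forall i, 0 < P i)
  (rho_ge0 : forall i j, 0 <= rho i j)
  (rho_sym : forall i j, rho i j = rho j i)
  (rho_eq0 : forall i j, rho i j = 0 <-> i = j)
  (Dmax_gt0 : 0 < Dmax P rho)
  (X1_meas : measurable_fun [set: Omega] (fun w => val (X1 w) : R))
  (X1_law : forall i : A, Pr [set w | X1 w = i] = (P i)%:E)
  (choice : forall D, 0 < D < Dmax P rho ->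
     optimal_choice P rho D (Qstar D) (lstar D))
  (R_convex : strictly_convex_on [set D | 0 < D < Dmax P rho]
     (fun D => fine (rate_distortion P rho D)))
  (f_zero : infinite_set [set D | 0 < D < Dmax P rho /\
     Pr [set w | f_dist P rho D (Qstar D) (lstar D) (X1 w) = 0] = 1%E]) :
  [/\ uniform_pmf P,
      permutation_distortion rho
    & forall D, 0 < D < Dmax P rho ->
        Pr [set w | f_dist P rho D (Qstar D) (lstar D) (X1 w) = 0] = 1%E].
Proof.
(* Every symbol has positive mass, so almost sure vanishing of [f_dist] is vanishing everywhere. *)
have f0P D := probability1_all
  [set x | f_dist P rho D (Qstar D) (lstar D) x = 0] X1_meas X1_law P_gt0.
have [Pu rho_perm] : uniform_pmf P /\ permutation_distortion rho.
  apply: (f_dist0_uniform P_pmf rho_ge0 rho_sym rho_eq0 R_convex _ f_zero).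
  - by move=> D [].
  - by move=> D [D_range _]; exact: choice.
  - by move=> D [_ D_zero]; apply/f0P.
split=> // D D_range; apply/f0P => x /=.
exact: (uniform_f_dist0 P_pmf Pu rho_ge0 rho_sym rho_eq0 rho_perm D_range
  (choice D D_range)).
Qed.
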